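(* Let $M\ge1$ be an integer, let $|\phi\rangle\in\mathbb{C}^2$ be a unit vector, and let $|\psi_0\rangle=|\phi\rangle^{\otimes M}$ (for instance $|\psi_0\rangle=|+\rangle^{\otimes M}$). For the $M$-qubit local depolarizing channel with error probability $p\in[0,1]$, the PQES error threshold for the target $|\psi_0\rangle$ is $$p_{\mathrm{th}}=\frac34,$$ independently of $M$. Moreover, $|\psi_0\rangle$ is the unique dominant eigenvector (eigenvector of a nondegenerate largest eigenvalue) of the noisy state $\mathcal{E}(|\psi_0\rangle\langle\psi_0|)$ if and only if $p<3/4$.
   Context: Local depolarizing channel: $\mathcal{E}=\mathcal{E}_1\circ\cdots\circ\mathcal{E}_M$ on operators on $(\mathbb{C}^2)^{\otimes M}$, where $$\mathcal{E}_m(\rho)=(1-p)\rho+\frac p3\left(X_m\rho X_m+Y_m\rho Y_m+Z_m\rho Z_m\right)$$ and $X_m,Y_m,Z_m$ are the Pauli operators acting on qubit $m$ and as the identity elsewhere. Purification map: for an integer $\ell\ge0$ and a density matrix $\rho$, $\mathcal{P}_\ell(\rho)=\rho^{N}/\mathrm{Tr}(\rho^{N})$ with $N=2^\ell$. Effective logical error rate: one cycle applies the error channel and then $\mathcal{P}_\ell$. With $F(t)$ the fidelity $\langle\psi_0|\rho|\psi_0\rangle$ after $t$ cycles starting from $|\psi_0\rangle\langle\psi_0|$, $$\gamma_L(\ell,p)=F(0)-F(1)=1-\langle\psi_0|\,\mathcal{P}_\ell\big(\mathcal{E}(|\psi_0\rangle\langle\psi_0|)\big)|\psi_0\rangle .$$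 PQES (purification quantum error suppression) error threshold: $p_{\mathrm{th}}$ is the largest value in $[0,1]$ such that $\lim_{\ell\to\infty}\gamma_L(\ell,p)=0$ for every $p\in[0,1]$ with $p<p_{\mathrm{th}}$. *)

(* Defs.v *)
From HB Require Import structures.
From mathcomp Require Import all_boot all_order all_algebra.
From mathcomp Require Import mxtens complex.
From mathcomp Require Import all_classical all_reals all_analysis.
Set Implicit Arguments.
Unset Strict Implicit.
Unset Printing Implicit Defensive.
Import Order.TTheory GRing.Theory Num.Theory.
Import numFieldNormedType.Exports.
Local Open Scope ring_scope.
Local Open Scope complex_scope.
Local Open Scope sesquilinear_scope.
Local Open Scope classical_set_scope.

Section Qubits.
Context {R : realType}.
Local Notation C := R[i].

Definition mx22 (a b c d : C) : 'M[C]_2 :=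
  \matrix_(i, j) if i == 0 then (if j == 0 then a else b)
                 else (if j == 0 then c else d).

Definition pauliX : 'M[C]_2 := mx22 0 1 1 0.
Definition pauliY : 'M[C]_2 := mx22 0 (- 'i%C) 'i%C 0.
Definition pauliZ : 'M[C]_2 := mx22 1 0 0 (-1).

Lemma qubit_dim M (m : 'I_M) : (2 ^ m * 2 * 2 ^ (M - m.+1) = 2 ^ M)%N.
Proof. by rewrite -expnSr -expnD subnKC. Qed.

(* [tensmx] is the Kronecker product, so this is 1 (x) A (x) 1 with m identity
   factors on the left and M - m - 1 on the right. *)
Definition on_qubit M (m : 'I_M) (A : 'M[C]_2) : 'M[C]_(2 ^ M) :=
  castmx (qubit_dim m, qubit_dim m)
    (tensmx (tensmx (1%:M : 'M[C]_(2 ^ m)) A) (1%:M : 'M[C]_(2 ^ (M - m.+1)))).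

(* The M-fold Kronecker power of a column has 1 ^ M columns. *)
Definition product_state (phi : 'cV[C]_2) M : 'cV[C]_(2 ^ M) :=
  castmx (erefl, exp1n M) (ntensmx phi M).

Definition depolarize_qubit M (p : R) (m : 'I_M) (rho : 'M[C]_(2 ^ M)) :=
  let conj_by A := on_qubit m A *m rho *m on_qubit m A in
  (1 - p)%:C *: rho
  + (p / 3)%:C *: (conj_by pauliX + conj_by pauliY + conj_by pauliZ).

Definition depolarize M (p : R) : 'M[C]_(2 ^ M) -> 'M[C]_(2 ^ M) :=
  \big[(fun f g => f \o g)/idfun]_(m < M) depolarize_qubit p m.

Definition purify d (l : nat) (rho : 'M[C]_d) : 'M[C]_d :=
  (\tr (rho ^+ (2 ^ l)))^-1 *: rho ^+ (2 ^ l).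

Definition ketbra d (psi : 'cV[C]_d) : 'M[C]_d := psi *m psi ^t*.

(* <psi|rho|psi> is real for the Hermitian rho considered here; [Re] only
   changes its type from C to R. *)
Definition fidelity d (psi : 'cV[C]_d) (rho : 'M[C]_d) : R :=
  complex.Re ((psi ^t* *m rho *m psi) 0 0).

Definition fidelity_after M (psi : 'cV[C]_(2 ^ M)) (l : nat) (p : R)
    (t : nat) : R :=
  fidelity psi (iter t (purify l \o depolarize p) (ketbra psi)).

Definition logical_error M (psi : 'cV[C]_(2 ^ M)) (l : nat) (p : R) : R :=
  fidelity_after psi l p 0 - fidelity_after psi l p 1.

Definition suppressed_below M (psi : 'cV[C]_(2 ^ M)) (t : R) : Prop :=
  forall p : R, 0 <= p <= 1 -> p < t ->
    (fun l => logical_error psi l p) @ \oo --> (0 : R).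

Definition is_error_threshold M (psi : 'cV[C]_(2 ^ M)) (t : R) : Prop :=
  [/\ 0 <= t <= 1, suppressed_below psi t &
      forall t', 0 <= t' <= 1 -> suppressed_below psi t' -> t' <= t].

(* [eigenspace] and [eigenvalue] concern row vectors, hence the transpose.
   The order on C relates only numbers with equal imaginary parts, which is
   harmless as A will be Hermitian: its eigenvalues are real, and the geometric
   and algebraic multiplicities agree. *)
Definition unique_dominant_eigenvector d (A : 'M[C]_d) (v : 'cV[C]_d) : Prop :=
  v != 0 /\ exists lambda : C,
    [/\ A *m v = lambda *: v,
        forall mu, eigenvalue A^T mu -> mu <= lambda &
        \rank (eigenspace A^T lambda) = 1%N].

End Qubits.

(* Main.v *)
Require Import Defs.
From HB Require Import structures.
From mathcomp Require Import all_boot all_order all_algebra.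
From mathcomp Require Import mxtens complex.
From mathcomp Require Import all_classical all_reals all_analysis.
From mathcomp Require Import zify ring lra.
Set Implicit Arguments.
Unset Strict Implicit.
Unset Printing Implicit Defensive.
Import Order.TTheory GRing.Theory Num.Theory.
Import numFieldNormedType.Exports.
Local Open Scope ring_scope.
Local Open Scope complex_scope.
Local Open Scope sesquilinear_scope.

(** A unit vector [phi] gives complementary projections [P = ketbra phi] and
    [Q = 1 - P], and one depolarized qubit is [a P + b Q] with [a = 1 - 2p/3] and
    [b = 2p/3]. The noisy state is the M-fold tensor power of [a P + b Q]: its
    eigenvalues are the products of [M] factors [a] or [b], with [psi_0] belonging
    to [a ^ M], and after purification with [N = 2 ^ l] its fidelity is
    [(a ^ N / (a ^ N + b ^ N)) ^ M]. Everything is thus decided by the comparison of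
    [a] and [b], which coincide exactly at [p = 3/4]. *)

(** * Binary digits of indices *)

Definition bit (k x : nat) : 'I_2 := inord (x %/ 2 ^ k %% 2).

Lemma val_bit k x : bit k x = (x %/ 2 ^ k %% 2)%N :> nat.
Proof. by rewrite inordK // ltn_pmod. Qed.

(** Induction on the number of digits: the parity is bit 0, and halving shifts the remaining bits
    down by one. *)
Lemma bit_inj n x y : (x < 2 ^ n)%N -> (y < 2 ^ n)%N ->
  (forall k, (k < n)%N -> bit k x = bit k y) -> x = y.
Proof.
elim: n x y => [|n IHn] x y; first by rewrite !ltnS !leqn0 => /eqP-> /eqP->.
move=> ltx lty eqb; rewrite (divn_eq x 2) (divn_eq y 2); congr (_ * 2 + _)%N.
  apply: IHn => [||k ltk]; rewrite ?ltn_divLR // -?expnSr //.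
  apply/val_inj; have := congr1 val (eqb k.+1 ltk).
  by rewrite /= !val_bit expnS !divnMA.
by have := congr1 val (eqb 0%N isT); rewrite /= !val_bit expn0 !divn1.
Qed.

Lemma bit_modn k t x : (k < t)%N -> bit k (x %% 2 ^ t) = bit k x.
Proof.
move=> ltkt; apply/val_inj; rewrite /= !val_bit !modn_divl.
by rewrite modn_dvdm // -expnS dvdn_exp2l.
Qed.

Lemma bit_divn k t x : bit k (x %/ 2 ^ t) = bit (t + k) x.
Proof. by rewrite /bit expnD divnMA. Qed.

(** Identity factors on both sides of a qubit compare quotients and remainders of indices; the
    quotient carries the bits above [t], the remainder those below. *)
Lemma eq_bits_except n t x y : (t < n)%N -> (x < 2 ^ n)%N -> (y < 2 ^ n)%N ->
  (forall k, (k < n)%N -> k != t -> bit k x = bit k y) <->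
  (x %/ 2 ^ t.+1 = y %/ 2 ^ t.+1 /\ x %% 2 ^ t = y %% 2 ^ t)%N.
Proof.
move=> ltn ltx lty; split=> [eqb|[eqd eqm] k ltk].
  split.
    apply: (@bit_inj (n - t.+1)) => [||k ltk].
    - by rewrite ltn_divLR ?expn_gt0 // -expnD subnK.
    - by rewrite ltn_divLR ?expn_gt0 // -expnD subnK.
    by rewrite !bit_divn eqb //; lia.
  apply: (@bit_inj t) => [||k ltk]; rewrite ?ltn_pmod ?expn_gt0 //.
  by rewrite !bit_modn // eqb //; lia.
rewrite neq_ltn => /orP[ltkt|lttk].
  by rewrite -(bit_modn x ltkt) eqm bit_modn.
by rewrite -(subnKC lttk) -!bit_divn eqd.
Qed.

(** * Tensor products of families of qubit matrices *)

Section TensorFamily.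
Variables (K : comNzRingType) (M : nat).

(* Qubit 0 is the leftmost Kronecker factor, hence the most significant bit. *)
Definition qubit (i : 'I_(2 ^ M)) (m : 'I_M) : 'I_2 := bit (rev_ord m) i.

Lemma qubit_rev i m : qubit i (rev_ord m) = bit m i.
Proof. by rewrite /qubit rev_ordK. Qed.

Lemma qubit_inj i j : qubit i =1 qubit j -> i = j.
Proof.
move=> eqij; apply/val_inj/(@bit_inj M) => [||k ltk]; rewrite ?ltn_ord //.
by rewrite -!(qubit_rev _ (Ordinal ltk)).
Qed.

(** Indices below [2 ^ M] correspond bijectively to words of [M] bits, by injectivity and counting,
    so this is distributivity. Products and traces of tensors both reduce to it. *)
Lemma sum_prod_qubit (F : 'I_M -> 'I_2 -> K) :
  \sum_i \prod_m F m (qubit i m) = \prod_m \sum_b F m b.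
Proof.
rewrite bigA_distr_bigA /=; pose h i := [ffun m => qubit i m].
have /inj_card_bij h_bij : injective h.
  by move=> i j /ffunP eqij; apply: qubit_inj => m; have := eqij m; rewrite !ffunE.
rewrite (reindex h) /=; last by apply: onW_bij; apply: h_bij; rewrite card_ffun !card_ord.
by apply: eq_bigr => i _; apply: eq_bigr => m _; rewrite ffunE.
Qed.

(* Working entrywise with the binary digits of the indices avoids the dimension
   casts of iterated Kronecker products. *)
Definition tens (A : 'I_M -> 'M[K]_2) : 'M[K]_(2 ^ M) :=
  \matrix_(i, j) \prod_m A m (qubit i m) (qubit j m).

Lemma eq_tens A B : A =1 B -> tens A = tens B.
Proof.
by move=> eqAB; apply/matrixP => i j; rewrite !mxE; apply: eq_bigr => m _; rewrite eqAB.
Qed.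

Lemma tensM A B : tens A *m tens B = tens (fun m => A m *m B m).
Proof.
apply/matrixP => i j; rewrite !mxE.
under [LHS]eq_bigr do rewrite !mxE -big_split /=.
rewrite (sum_prod_qubit (fun m b => A m (qubit i m) b * B m b (qubit j m))).
by apply: eq_bigr => m _; rewrite mxE.
Qed.

Lemma tr_tens A : \tr (tens A) = \prod_m \tr (A m).
Proof.
rewrite /mxtrace; under [LHS]eq_bigr do rewrite mxE.
by rewrite (sum_prod_qubit (fun m b => A m b b)).
Qed.

Lemma prod_eq_bits (P : pred 'I_M) i j :
  \prod_(m | P m) (1%:M : 'M[K]_2) (qubit i m) (qubit j m) =
  [forall (m | P m), qubit i m == qubit j m]%:R.
Proof.
case: forall_inP => [eqij|neqij].
  by rewrite big1 // => m Pm; rewrite mxE eqij.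
have /forall_inPn[m Pm neqm] : ~~ [forall (m | P m), qubit i m == qubit j m].
  by apply/forall_inP.
by rewrite (bigD1 m) //= mxE (negPf neqm) mul0r.
Qed.

Lemma tens1 : tens (fun=> 1%:M) = 1%:M.
Proof.
apply/matrixP => i j; rewrite !mxE prod_eq_bits; congr (nat_of_bool _)%:R.
apply/forall_inP/eqP => [eqij|-> m _]; last exact: eqxx.
by apply: qubit_inj => m; exact/eqP/eqij.
Qed.

Lemma tensZ (c : 'I_M -> K) A : tens (fun m => c m *: A m) = (\prod_m c m) *: tens A.
Proof.
by apply/matrixP => i j; rewrite !mxE -big_split; apply: eq_bigr => m _; rewrite mxE.
Qed.

Lemma sum_tens (A : 'I_M -> 'I_2 -> 'M[K]_2) :
  \sum_(s : {ffun 'I_M -> 'I_2}) tens (fun m => A m (s m)) = tens (fun m => \sum_b A m b).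
Proof.
apply/matrixP => i j; rewrite summxE mxE; under [LHS]eq_bigr do rewrite mxE.
by under [RHS]eq_bigr do rewrite summxE; rewrite bigA_distr_bigA.
Qed.

(** A tensor is linear in each slot separately; replacing a single slot expresses the action of a
    one-qubit operation. *)
Definition upd (A : 'I_M -> 'M[K]_2) m B k := if k == m then B else A k.

Lemma tens_updE A m B i j : tens (upd A m B) i j =
  B (qubit i m) (qubit j m) * \prod_(k | k != m) A k (qubit i k) (qubit j k).
Proof.
rewrite mxE (bigD1 m) //= /upd eqxx; congr (_ * _).
by apply: eq_bigr => k /negPf->.
Qed.

Lemma tens_upd_same A m : tens (upd A m (A m)) = tens A.
Proof. by apply: eq_tens => k; rewrite /upd; case: eqP => [->|]. Qed.

Lemma tens_updD A m B C : tens (upd A m (B + C)) = tens (upd A m B) + tens (upd A m C).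
Proof. by apply/matrixP => i j; rewrite [RHS]mxE !tens_updE mxE mulrDl. Qed.

Lemma tens_updZ A m c B : tens (upd A m (c *: B)) = c *: tens (upd A m B).
Proof. by apply/matrixP => i j; rewrite [RHS]mxE !tens_updE mxE mulrA. Qed.

End TensorFamily.
Arguments qubit {M}.

(** * Kronecker products read through binary digits *)

Section Qubits.
Context {R : realType}.
Local Notation C := R[i].

(** In mixed radix, an index has qubit [m] as its middle digit; the two identity factors become
    Kronecker deltas on the outer digits, that is, on all other qubits. *)
Lemma on_qubitE M (m : 'I_M) (A : 'M[C]_2) :
  on_qubit m A = tens (upd (fun=> 1%:M) m A).
Proof.
apply/matrixP => i j; rewrite tens_updE prod_eq_bits castmxE !mxE /=.
set i1 := (X in X == _); set j1 := (X in _ == X).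
rewrite mulrAC -natrM mulnb mulrC; congr (_ * (nat_of_bool _)%:R).
  congr (A _ _); apply/val_inj; rewrite /= val_bit /=.
    by [].
  by [].
rewrite -!val_eqE /= -!divnMA -!expnSr.
have eqb := eq_bits_except (ltn_ord (rev_ord m)) (ltn_ord i) (ltn_ord j).
apply/andP/forall_inP => [[/eqP eqd /eqP eqm] k neqkm|eqij].
  apply/eqP/(iffRL eqb (conj eqd eqm)); first exact: ltn_ord.
  by rewrite val_eqE (inj_eq rev_ord_inj).
suff [-> ->] : (i %/ 2 ^ (M - m.+1).+1 = j %/ 2 ^ (M - m.+1).+1 /\
  i %% 2 ^ (M - m.+1) = j %% 2 ^ (M - m.+1))%N by [].
apply/eqb => k ltk neqk; rewrite -!(qubit_rev _ (Ordinal ltk)).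
apply/eqP/eqij; apply: contraNneq neqk => <-; by rewrite rev_ordK.
Qed.

(** [ntensmx_rec phi n] has [n.+1] factors; peeling off the leftmost one separates the leading bit,
    a quotient, from the others, a remainder. *)
Lemma ntensmx_recE (phi : 'cV[C]_2) n (i : 'I_(2 ^ n.+1)) j :
  ntensmx_rec phi n i j = \prod_(k < n.+1) phi (bit (n - k) i) 0.
Proof.
elim: n i j => [|n IHn] i j.
  rewrite big_ord1 /= subn0 (ord1 j); congr (phi _ _).
  by apply/ord_inj; rewrite val_bit expn0 divn1 modn_small.
rewrite /= mxE IHn [RHS]big_ord_recl subn0 ord1; congr (phi _ _ * _).
  apply/ord_inj; rewrite val_bit /= modn_small //.
  by rewrite ltn_divLR ?expn_gt0 // -expnS.
by apply: eq_bigr => k _; rewrite /= bit_modn // ltnS leq_subr.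
Qed.

Lemma product_stateE (phi : 'cV[C]_2) M i :
  product_state phi M i 0 = \prod_m phi (qubit i m) 0.
Proof.
rewrite castmxE; case: M i => [|n] i /=; last first.
  rewrite /ntensmx ntensmx_recE; apply: eq_bigr => k _.
  by rewrite /qubit /= subSS.
(* For [M = 0] the only index is 0 and both sides equal 1. *)
by rewrite big_ord0 mxE -val_eqE; case: i => [[|[]]].
Qed.

Lemma ketbra_product (phi : 'cV[C]_2) M :
  ketbra (product_state phi M) = tens (fun=> ketbra phi).
Proof.
apply/matrixP => i j; rewrite !mxE big_ord1 !mxE !product_stateE rmorph_prod -big_split /=.
by apply: eq_bigr => m _; rewrite !mxE big_ord1 !mxE.
Qed.

(** * The depolarizing channel on tensor products *)

Definition depolarize1 (p : R) (A : 'M[C]_2) : 'M[C]_2 :=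
  (1 - p)%:C *: A + (p / 3)%:C *:
    (pauliX *m A *m pauliX + pauliY *m A *m pauliY + pauliZ *m A *m pauliZ).

Lemma on_qubit_conj M (m : 'I_M) (B : 'M[C]_2) A :
  on_qubit m B *m tens A *m on_qubit m B = tens (upd A m (B *m A m *m B)).
Proof.
rewrite !on_qubitE !tensM; apply: eq_tens => k; rewrite /upd.
by case: eqP => [->|_]; rewrite ?mul1mx ?mulmx1.
Qed.

Lemma depolarize_qubit_tens M p (m : 'I_M) A :
  depolarize_qubit p m (tens A) = tens (upd A m (depolarize1 p (A m))).
Proof.
rewrite /depolarize_qubit; have := on_qubit_conj m ^~ A.
move: (on_qubit m) => Q conjE; rewrite !conjE.
by rewrite tens_updD !tens_updZ !tens_updD tens_upd_same.
Qed.

Lemma depolarize_tens M p (A : 'I_M -> 'M[C]_2) :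
  depolarize p (tens A) = tens (fun m => depolarize1 p (A m)).
Proof.
rewrite /depolarize.
(* In a duplicate-free list, [m] does not occur in the tail, so its slot still holds [A m] when its
   channel acts. *)
have H r : uniq r -> (\big[(fun f g => f \o g)/idfun]_(m <- r) depolarize_qubit p m) (tens A)
    = tens (fun m => if m \in r then depolarize1 p (A m) else A m).
  elim: r => [_|m r IHr /= /andP[mNr /IHr{}IHr]]; first by rewrite big_nil.
  rewrite big_cons /= IHr depolarize_qubit_tens (negPf mNr).
  by apply: eq_tens => k; rewrite /upd inE; case: eqP => [->|_].
by rewrite H ?index_enum_uniq //; apply: eq_tens => m; rewrite mem_index_enum.
Qed.

Lemma sum_ord2 (V : nmodType) (F : 'I_2 -> V) : \sum_i F i = F 0 + F 1.
Proof. by rewrite !big_ord_recl big_ord0 addr0; congr (_ + F _); apply/val_inj. Qed.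

Lemma mx22_eta (A : 'M[C]_2) : A = mx22 (A 0 0) (A 0 1) (A 1 0) (A 1 1).
Proof.
apply/matrixP => i j; rewrite mxE.
by case: i j => [[|[|]]] // hi [[|[|]]] // hj /=; congr (A _ _); apply/val_inj.
Qed.

Lemma mul_mx22 (a b c d a' b' c' d' : C) : mx22 a b c d *m mx22 a' b' c' d' =
  mx22 (a * a' + b * c') (a * b' + b * d') (c * a' + d * c') (c * b' + d * d').
Proof.
by apply/matrixP => i j; rewrite !mxE sum_ord2 !mxE /=; case: (i == 0); case: (j == 0).
Qed.

Lemma add_mx22 (a b c d a' b' c' d' : C) : mx22 a b c d + mx22 a' b' c' d' =
  mx22 (a + a') (b + b') (c + c') (d + d').
Proof. by apply/matrixP => i j; rewrite !mxE; case: (i == 0); case: (j == 0). Qed.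

(** Pauli twirl: with [A] added as the conjugate by the identity, the sum is the scalar matrix
    [2 * \tr A]. This form is checked entrywise. *)
Lemma sum_pauli_conj (A : 'M[C]_2) :
  pauliX *m A *m pauliX + pauliY *m A *m pauliY + pauliZ *m A *m pauliZ =
  (2 * \tr A)%:M - A.
Proof.
have i2 : ('i%C : C) * 'i%C = -1 by rewrite -expr2 sqr_i.
apply/eqP; rewrite eq_sym subr_eq; apply/eqP.
rewrite /mxtrace sum_ord2 [in RHS](mx22_eta A) /pauliX /pauliY /pauliZ !mul_mx22 !add_mx22.
rewrite [LHS]mx22_eta !mxE /=.
have YY (x : C) : - 'i%C * x * 'i%C = x by rewrite mulrAC mulNr i2 opprK mul1r.
have YY' (x : C) : 'i%C * x * - 'i%C = x by rewrite mulrAC mulrN i2 opprK mul1r.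
have YN (x : C) : 'i%C * x * 'i%C = - x by rewrite mulrAC i2 mulN1r.
have NY (x : C) : - 'i%C * x * - 'i%C = - x by rewrite mulrAC mulrNN i2 mulN1r.
congr (mx22 _ _ _ _); rewrite !(mul0r, mulr0, add0r, addr0) ?YY ?YY' ?YN ?NY; ring.
Qed.

Lemma depolarize1E p (A : 'M[C]_2) : \tr A = 1 ->
  depolarize1 p A = (1 - 2 * p / 3)%:C *: A + (2 * p / 3)%:C *: (1%:M - A).
Proof.
move=> trA; rewrite /depolarize1 sum_pauli_conj trA mulr1.
(* In terms of [q = p / 3] all coefficients are polynomial, so no division remains after the cast to
   complex numbers. *)
have -> : 1 - p = 1 - 3 * (p / 3) by field.
rewrite -mulrA; move: (p / 3) => q; rewrite !(rmorphB, rmorphM, rmorph_nat, rmorph1) /=.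
by move: (q%:C) => z; apply/matrixP => i j; rewrite !mxE; case: (i == j); ring.
Qed.

(** * Powers of the noisy state and the logical error rate *)

Section ProductState.
Variables (phi : 'cV[C]_2) (M : nat).
Hypothesis hphi : phi ^t* *m phi = 1%:M.
Local Notation psi := (product_state phi M).

Definition mix (a b : C) : 'M[C]_2 := a *: ketbra phi + b *: (1%:M - ketbra phi).

Lemma ketbra_idem : ketbra phi *m ketbra phi = ketbra phi.
Proof. by rewrite /ketbra mulmxA -(mulmxA phi) hphi mulmx1. Qed.

Lemma tr_ketbra : \tr (ketbra phi) = 1.
Proof. by rewrite mxtrace_mulC hphi mxtrace1. Qed.

Lemma mix10 : mix 1 0 = ketbra phi.
Proof. by rewrite /mix scale1r scale0r addr0. Qed.

Lemma mix_scalar a : mix a a = a%:M.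
Proof. by rewrite /mix -scalerDr addrC subrK scalemx1. Qed.

(** The two projections are idempotent and annihilate each other, so the cross terms vanish. *)
Lemma mixM a b c d : mix a b *m mix c d = mix (a * c) (b * d).
Proof.
have PQ : ketbra phi *m (1%:M - ketbra phi) = 0.
  by rewrite mulmxBr mulmx1 ketbra_idem subrr.
have QP : (1%:M - ketbra phi) *m ketbra phi = 0.
  by rewrite mulmxBl mul1mx ketbra_idem subrr.
have QQ : (1%:M - ketbra phi) *m (1%:M - ketbra phi) = 1%:M - ketbra phi.
  by rewrite mulmxBr mulmx1 QP subr0.
rewrite /mix; move: (ketbra phi) (1%:M - _) ketbra_idem PQ QP QQ => P Q PP PQ QP QQ.
rewrite mulmxDl !mulmxDr -!scalemxAl -!scalemxAr PP PQ QP QQ.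
by rewrite !scaler0 add0r addr0 !scalerA.
Qed.

Lemma tr_mix a b : \tr (mix a b) = a + b.
Proof.
rewrite linearD !linearZ /= linearB /= mxtrace1 tr_ketbra.
by ring.
Qed.

Lemma scale_mix c a b : c *: mix a b = mix (c * a) (c * b).
Proof. by rewrite /mix scalerDr !scalerA. Qed.

Lemma tens_mixX a b N :
  (tens (fun=> mix a b) : 'M[C]_(2 ^ M)) ^+ N = tens (fun=> mix (a ^+ N) (b ^+ N)).
Proof.
elim: N => [|N IHN].
  by rewrite !expr0 -[LHS]tens1; apply: eq_tens => m; rewrite mix_scalar.
by rewrite !exprS IHN -mulmxE tensM; apply: eq_tens => m; rewrite mixM.
Qed.

Lemma depolarize_product p : depolarize p (ketbra psi) =
  tens (fun=> mix (1 - 2 * p / 3)%:C (2 * p / 3)%:C).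
Proof.
by rewrite ketbra_product depolarize_tens; apply: eq_tens => m; rewrite depolarize1E ?tr_ketbra.
Qed.

(** By cyclicity the squared norm is the trace of [ketbra psi], which factors over the qubits. *)
Lemma product_state_norm : psi ^t* *m psi = 1%:M.
Proof.
rewrite [LHS]mx11_scalar -trace_mx11 mxtrace_mulC -/(ketbra psi) ketbra_product tr_tens.
by rewrite big1 // => m _; rewrite tr_ketbra.
Qed.

Lemma product_state_neq0 : psi != 0.
Proof.
apply/eqP => psi0; have /eqP := product_state_norm.
by rewrite psi0 mulmx0 eq_sym oner_eq0.
Qed.

(** The state is fixed by the tensor power of [mix 1 0], and multiplication by the latter removes
    the [b] part in every slot. *)
Lemma tens_mix_product_state a b : tens (fun=> mix a b) *m psi = a ^+ M *: psi.
Proof.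
have psiE : psi = tens (fun=> mix 1 0) *m psi.
  rewrite (eq_tens (fun=> mix10)) -ketbra_product.
  by rewrite /ketbra -mulmxA product_state_norm mulmx1.
rewrite [in LHS]psiE mulmxA tensM (eq_tens (fun=> mixM _ _ _ _)) mulr1 mulr0.
rewrite (@eq_tens _ _ _ (fun=> a *: mix 1 0)); last first.
  by move=> m; rewrite scale_mix mulr1 mulr0.
by rewrite tensZ prodr_const card_ord -scalemxAl -psiE.
Qed.

(** With [N = 2 ^ l], the unnormalized overlap is [(a ^ N) ^ M] and the trace is
    [(a ^ N + b ^ N) ^ M]; the initial fidelity is 1. *)
Lemma logical_errorE l p :
  let a := 1 - 2 * p / 3 in let b := 2 * p / 3 in
  logical_error psi l p = 1 - (a ^+ (2 ^ l) / (a ^+ (2 ^ l) + b ^+ (2 ^ l))) ^+ M.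
Proof.
move=> a b; rewrite /logical_error /fidelity_after /= /fidelity /purify; congr (_ - _).
  by rewrite /ketbra mulmxA product_state_norm mul1mx product_state_norm mxE.
rewrite depolarize_product -/a -/b tens_mixX -scalemxAr -scalemxAl -mulmxA.
rewrite tens_mix_product_state -scalemxAr product_state_norm scalerA tr_tens.
rewrite prodr_const card_ord tr_mix -!rmorphXn -rmorphD.
rewrite -rmorphXn -fmorphV -rmorphM !mxE mulr1n mulr1.
by rewrite [RHS]exprMn exprVn [RHS]mulrC.
Qed.
End ProductState.

(** * The limit of the purified ratio *)

Section PurifiedRatio.
Local Open Scope classical_set_scope.

(** Dividing through by [a ^ N], with [N = 2 ^ l], turns the ratio into [1 / (1 + r ^ N)], where
    [r = b / a < 1]. *)
Lemma cvg_purified_ratio (M : nat) (a b : R) : 0 <= b < a ->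
  (fun l => 1 - (a ^+ (2 ^ l) / (a ^+ (2 ^ l) + b ^+ (2 ^ l))) ^+ M) @ \oo
    --> (0 : R).
Proof.
move=> /andP[b0 ltba]; have a0 : 0 < a := le_lt_trans b0 ltba.
pose r := b / a; have r0 : 0 <= r by rewrite divr_ge0 // ltW.
have r1 : r < 1 by rewrite ltr_pdivrMr ?mul1r.
have r2l : (fun l => r ^+ (2 ^ l)) @ \oo --> (0 : R).
  (* Since [l <= 2 ^ l] and [0 <= r <= 1], the geometric sequence [r ^ l] is an upper bound. *)
  apply: (@squeeze_cvgr _ _ _ _ (fun=> 0) (fun l => r ^+ l)); last 2 first.
  - exact: cvg_cst.
  - by apply: cvg_expr; rewrite ger0_norm.
  near=> l; rewrite exprn_ge0 //= ler_wiXn2l ?(ltW r1) //.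
  exact/ltnW/ltn_expl.
have -> : (fun l => 1 - (a ^+ (2 ^ l) / (a ^+ (2 ^ l) + b ^+ (2 ^ l))) ^+ M) =
          (fun l => 1 - ((1 + r ^+ (2 ^ l))^-1) ^+ M).
  apply/funext => l; congr (1 - _ ^+ M).
  have aN : 0 < a ^+ (2 ^ l) by rewrite exprn_gt0.
  have bN : 0 <= b ^+ (2 ^ l) by rewrite exprn_ge0.
  rewrite /r expr_div_n; field; rewrite ?gt_eqF //; lra.
have -> : (0 : R) = 1 - ((1 + 0)^-1) ^+ M by rewrite addr0 invr1 expr1n subrr.
apply: cvgB; first exact: cvg_cst.
apply: (@cvg_comp _ _ _ (fun l => (1 + r ^+ (2 ^ l))^-1) (fun x => x ^+ M));
  last exact: exprn_continuous.
apply: cvgV; first by rewrite addr0 oner_eq0.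
by apply: cvgD => //; exact: cvg_cst.
Unshelve. all: by end_near.
Qed.

End PurifiedRatio.

(** * Spectral decomposition of the noisy state *)

Section Spectrum.
Variables (phi : 'cV[C]_2) (M : nat).
Hypothesis hphi : phi ^t* *m phi = 1%:M.
Local Notation psi := (product_state phi M).
Local Notation word := {ffun 'I_M -> 'I_2}.

(** Letter 0 selects the projection onto [phi], letter 1 the one onto its orthogonal complement;
    these tensors diagonalize all tensor powers of [mix phi a b] simultaneously. *)
Definition spectral_proj (s : word) : 'M[C]_(2 ^ M) :=
  tens (fun m => if s m == 0 then mix phi 1 0 else mix phi 0 1).

(** Expansion of the tensor power of [P + Q = 1]. *)
Lemma sum_spectral_proj : \sum_s spectral_proj s = 1%:M.
Proof.
rewrite (sum_tens (fun=> fun b => if b == 0 then mix phi 1 0 else mix phi 0 1)) -[RHS]tens1.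
apply: eq_tens => m; rewrite sum_ord2 /= /mix !scale1r !scale0r addr0 add0r.
by rewrite addrC subrK.
Qed.

Lemma spectral_proj_mix (s : word) a b :
  spectral_proj s *m tens (fun=> mix phi a b) =
  (\prod_m (if s m == 0 then a else b)) *: spectral_proj s.
Proof.
rewrite tensM -tensZ; apply: eq_tens => m.
by case: ifP => _; rewrite mixM // scale_mix !mul1r !mul0r mulr1 mulr0.
Qed.

(** Applying the projection to the eigenvalue equation replaces the matrix by the scalar of the
    word, so the difference of the two scalars annihilates the projected vector. *)
Lemma spectral_proj_eigen (s : word) a b mu (w : 'cV[C]_(2 ^ M)) :
  tens (fun=> mix phi a b) *m w = mu *: w ->
  mu = \prod_m (if s m == 0 then a else b) \/ spectral_proj s *m w = 0.
Proof.
move=> eig; have : (mu - \prod_m (if s m == 0 then a else b)) *: (spectral_proj s *m w) = 0.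
  by rewrite scalerBl scalemxAr -eig mulmxA spectral_proj_mix -scalemxAl subrr.
by move/eqP; rewrite scaler_eq0 subr_eq0 => /orP[] /eqP; [left|right].
Qed.

Lemma spectral_proj0 : spectral_proj [ffun=> 0] = ketbra psi.
Proof. by rewrite ketbra_product; apply: eq_tens => m; rewrite ffunE eqxx mix10. Qed.

Variables (a b : R).
Hypotheses (a0 : 0 <= a) (b0 : 0 <= b).
Local Notation rho := (tens (fun=> mix phi a%:C b%:C) : 'M[C]_(2 ^ M)).

Lemma prod_word_real (s : word) :
  \prod_m (if s m == 0 then a%:C else b%:C) = (\prod_m (if s m == 0 then a else b))%:C.
Proof. by rewrite rmorph_prod; apply: eq_bigr => m _; case: ifP. Qed.

(** Some slot contributes [b < a], and the product over the others is at most a positive power of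
    [a]. *)
Lemma prod_word_lt (s : word) : b < a -> s != [ffun=> 0] ->
  \prod_m (if s m == 0 then a else b) < a ^+ M.
Proof.
move=> ltba sN0; have agt0 : 0 < a := le_lt_trans b0 ltba.
have [m sm] : exists m, s m != 0.
  apply/existsP; apply: contraNT sN0 => /existsPn s0.
  by apply/eqP/ffunP => m; rewrite ffunE; apply/eqP; rewrite -[_ == _]negbK s0.
rewrite -[M in a ^+ M]card_ord -prodr_const (bigD1 m) //= [ltRHS](bigD1 m) //= (negPf sm).
have leP : \prod_(i < M | i != m) (if s i == 0 then a else b) <= \prod_(i < M | i != m) a.
  by apply: ler_prod => i _; case: ifP => _; rewrite ?a0 ?b0 ?lexx // (ltW ltba).
apply: (le_lt_trans (ler_wpM2l b0 leP)).
by rewrite ltr_pM2r // prodr_gt0.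
Qed.

(** An eigenvector has a nonzero component along some word, so its eigenvalue is the product over
    that word, at most [a ^ M]. For [a ^ M] itself only the all-zero word contributes, which leaves
    multiples of [psi]. *)
Lemma unique_dominant_product_state : b < a -> unique_dominant_eigenvector rho psi.
Proof.
move=> ltba; split; first exact: product_state_neq0.
exists (a%:C ^+ M); split; first exact: tens_mix_product_state.
- move=> mu /eigenvalueP[v eigv vN0].
  have eigw : rho *m v^T = mu *: v^T by rewrite -[rho]trmxK -trmx_mul eigv linearZ.
  have [s ws] : exists s, spectral_proj s *m v^T != 0.
    apply/existsP; apply: contraNT vN0 => /existsPn v0.
    rewrite -(inj_eq trmx_inj) trmx0 -[v^T]mul1mx -sum_spectral_proj mulmx_suml.
    by rewrite big1 // => s _; apply/eqP; rewrite -[_ == _]negbK v0.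
  case: (spectral_proj_eigen s eigw) ws => [->|-> /eqP//] _.
  rewrite prod_word_real -rmorphXn lecR.
  by have [->|/(prod_word_lt ltba)/ltW//] := eqVneq s [ffun=> 0];
    under eq_bigr do rewrite ffunE eqxx; rewrite prodr_const card_ord.
(* The rank is at least one because of [psi], and at most one because the eigenspace lies in the row
   span of [psi^T]. *)
apply/eqP; rewrite eqn_leq; apply/andP; split; last first.
  rewrite lt0n mxrank_eq0; apply/eqP => eig0.
  have : (psi^T <= eigenspace rho^T (a%:C ^+ M))%MS.
    apply/eigenspaceP; rewrite -trmx_mul tens_mix_product_state //.
    by rewrite linearZ.
  by rewrite eig0 submx0 -(inj_eq trmx_inj) trmxK trmx0 (negPf (product_state_neq0 _ hphi)).
apply: leq_trans (rank_leq_row psi^T); apply: mxrankS; apply/rV_subP => v /eigenspaceP eigv.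
have eigw : rho *m v^T = a%:C ^+ M *: v^T by rewrite -[rho]trmxK -trmx_mul eigv linearZ.
have wE : v^T = psi *m (psi ^t* *m v^T).
  rewrite -[LHS]mul1mx -sum_spectral_proj mulmx_suml (bigD1 [ffun=> 0]) //= big1 ?addr0.
    by rewrite spectral_proj0 /ketbra mulmxA.
  move=> s /(prod_word_lt ltba) lts; case: (spectral_proj_eigen s eigw) => // eqs.
  by move: lts; rewrite -ltcR rmorphXn /= eqs prod_word_real ltxx.
by rewrite -[v]trmxK wE trmx_mul submxMl.
Qed.

(** The tensor power of [Q] exhibits [b ^ M] as an eigenvalue, whence [b <= a]. Equality would make
    the noisy state scalar, with an eigenspace of dimension [2 ^ M > 1]. *)
Lemma unique_dominant_product_state_lt :
  (0 < M)%N -> unique_dominant_eigenvector rho psi -> b < a.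
Proof.
move=> M0 [psi0 [lam [eigpsi dom rank1]]].
have lamE : lam = a%:C ^+ M.
  have : (lam - a%:C ^+ M) *: psi = 0.
    by rewrite scalerBl -eigpsi tens_mix_product_state // subrr.
  by move/eqP; rewrite scaler_eq0 (negPf psi0) orbF subr_eq0 => /eqP.
have eigb : eigenvalue rho^T (b%:C ^+ M).
  pose W : 'M[C]_(2 ^ M) := tens (fun=> mix phi 0 1).
  have : (W^T <= eigenspace rho^T (b%:C ^+ M))%MS.
    apply/eigenspaceP; rewrite -trmx_mul -linearZ /=; congr trmx.
    rewrite tensM -[M in _ ^+ M]card_ord -prodr_const -tensZ; apply: eq_tens => m.
    by rewrite mixM // scale_mix mulr0 !mulr1 mulr0.
  apply: contraTneq => ->; rewrite submx0 -(inj_eq trmx_inj) trmxK trmx0.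
  (* [W] is nonzero because its trace is 1. *)
  apply/eqP => W0; have := tr_tens (fun _ : 'I_M => mix phi 0 1).
  rewrite -/W W0 mxtrace0 big1 => [/eqP|m _]; last by rewrite tr_mix // add0r.
  by rewrite eq_sym oner_eq0.
have : b <= a.
  have := dom _ eigb; rewrite lamE -!rmorphXn lecR.
  by rewrite ler_pXn2r.
rewrite le_eqVlt => /orP[/eqP eqba|//].
have rhoE : rho^T = (a%:C ^+ M)%:M.
  rewrite (@eq_tens _ _ _ (fun=> a%:C *: 1%:M)); last by move=> m; rewrite eqba mix_scalar scalemx1.
  by rewrite tensZ prodr_const card_ord tens1 scalemx1 tr_scalar_mx.
move: rank1; rewrite /eigenspace rhoE lamE subrr mxrank_ker mxrank0 subn0.
by move/eqP; rewrite -(expn0 2) eqn_exp2l // => /eqP M00; rewrite M00 in M0.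
Qed.
End Spectrum.
End Qubits.

Theorem mainTheorem3 (R : realType) (M : nat) (hM : (1 <= M)%N)
    (phi : 'cV[R[i]]_2) (hphi : phi ^t* *m phi = 1%:M) :
  is_error_threshold (product_state phi M) (3 / 4) /\
  (forall p : R, 0 <= p <= 1 ->
     (unique_dominant_eigenvector
        (depolarize p (ketbra (product_state phi M))) (product_state phi M)
      <-> p < 3 / 4)).
Proof.
split; last first.
  move=> p /andP[p0 p1]; rewrite depolarize_product //.
  have [ge0a ge0b] : 0 <= 1 - 2 * p / 3 /\ 0 <= 2 * p / 3 by split; lra.
  split=> [/unique_dominant_product_state_lt H|ltp].
    have : 2 * p / 3 < 1 - 2 * p / 3 by exact: H.
    lra.
  by apply: unique_dominant_product_state => //; lra.
split; first by apply/andP; split; lra.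
  move=> p /andP[p0 p1] ltp.
  have -> : (fun l => logical_error (product_state phi M) l p) = (fun l => 1 -
      ((1 - 2 * p / 3) ^+ (2 ^ l) / ((1 - 2 * p / 3) ^+ (2 ^ l) + (2 * p / 3) ^+ (2 ^ l))) ^+ M).
    by apply/funext => l; rewrite logical_errorE.
  by apply: cvg_purified_ratio; apply/andP; split; lra.
(* A larger threshold would require suppression at [p = 3 / 4] itself, where [a = b = 1 / 2] and the
   error is the same positive constant for every [l]. *)
move=> t /andP[t0 t1] supp; rewrite leNgt; apply/negP => lt_t.
have range : 0 <= (3 / 4 : R) <= 1 by apply/andP; split; lra.
have := supp _ range lt_t.
have -> : (fun l => logical_error (product_state phi M) l (3 / 4)) =
          (fun=> 1 - 2^-1 ^+ M).
  apply/funext => l; rewrite logical_errorE //; congr (1 - _ ^+ M).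
  have -> : 1 - 2 * (3 / 4) / 3 = 2^-1 :> R by field.
  have -> : 2 * (3 / 4) / 3 = 2^-1 :> R by field.
  have : (2^-1 : R) ^+ (2 ^ l) != 0 by rewrite expf_neq0 // invr_eq0 pnatr_eq0.
  by move: (_ ^+ _) => x x0; field; rewrite -mulr2n mulrn_eq0.
(* Uniqueness of limits would force [2^-1 ^ M = 1], impossible for [M >= 1]. *)
move=> /(cvg_unique (@norm_hausdorff _ _) (@cvg_cst _ _ _ _ _)) /eqP.
rewrite subr_eq0 eq_sym => /eqP pow1.
have : (2^-1 : R) ^+ M < 1 by rewrite exprn_ilt1 -?lt0n //; lra.
by rewrite pow1 ltxx.
Qed.
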